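(* Let $H=(V,E)$ be a finite linear $3$-uniform hypergraph with $m=|E|$ edges. Then $\tau_c(H)\le m/3$.
   Context: A hypergraph $H=(V,E)$ consists of a finite vertex set $V$ and a set $E$ of edges, each edge being a subset of $V$. $H$ is $3$-uniform if $|e|=3$ for each $e\in E$, and linear if $|e\cap f|\le 1$ for any distinct edges $e,f\in E$. For an integer $k\ge 2$, a cycle of length $k$ in $H$ is a sequence $v_1e_1v_2e_2\cdots v_ke_kv_1$ such that $e_1,\dots,e_k$ are distinct edges of $H$, $v_1,\dots,v_k$ are distinct vertices of $H$, and $\{v_i,v_{i+1}\}\subseteq e_i$ for each $i\in\{1,\dots,k\}$, where $v_{k+1}=v_1$. For $S\subseteq V$, $H\setminus S$ is the hypergraph obtained from $H$ by deleting the vertices of $S$ together with all edges that contain at least one vertex of $S$. A set $S\subseteq V$ is a feedback vertex set (FVS) of $H$ if $H\setminus S$ has no cycle. $\tau_c(H)$ denotes the minimum cardinality of a FVS of $H$. *)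

(* Defs.v *)
From mathcomp Require Import all_boot all_order all_algebra.

Set Implicit Arguments.
Unset Strict Implicit.
Unset Printing Implicit Defensive.

Record hypergraph (T : finType) := Hypergraph {
  vset : {set T};
  eset : {set {set T}};
  eset_sub : {in eset, forall e : {set T}, e \subset vset}
}.

Definition uniform (r : nat) (T : finType) (H : hypergraph T) : Prop :=
  {in eset H, forall e : {set T}, #|e| = r}.

Definition linear_hypergraph (T : finType) (H : hypergraph T) : Prop :=
  {in eset H &, forall e f : {set T}, e != f -> #|e :&: f| <= 1}.

Lemma del_vertices_sub (T : finType) (H : hypergraph T) (S : {set T}) :
  {in [set e in eset H | [disjoint e & S]],
    forall e : {set T}, e \subset vset H :\: S}.
Proof.
by move=> e; rewrite inE => /andP[eH eS]; rewrite subsetD eS (eset_sub eH).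
Qed.

Definition del_vertices (T : finType) (H : hypergraph T) (S : {set T}) :
    hypergraph T :=
  Hypergraph (@del_vertices_sub T H S).

(* Indices run over {0, ..., k-1} instead of {1, ..., k}; [ordS] is the cyclic
   successor, so that v_{k+1} = v_1 is built in. *)
Definition is_cycle (T : finType) (H : hypergraph T) (k : nat)
    (v : {ffun 'I_k -> T}) (e : {ffun 'I_k -> {set T}}) : bool :=
  [&& 2 <= k,
      injectiveb e, [forall i, e i \in eset H],
      injectiveb v, [forall i, v i \in vset H]
    & [forall i, [set v i; v (ordS i)] \subset e i]].

Definition has_cycle (T : finType) (H : hypergraph T) : Prop :=
  exists (k : nat) (v : {ffun 'I_k -> T}) (e : {ffun 'I_k -> {set T}}),
    is_cycle H v e.

(* A cycle has at most #|T| vertices, so the search for one is finite. *)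
Lemma has_cycle_dec (T : finType) (H : hypergraph T) : decidable (has_cycle H).
Proof.
apply: (@decP _ [exists k : 'I_#|T|.+1, [exists v : {ffun 'I_k -> T},
  [exists e : {ffun 'I_k -> {set T}}, is_cycle H v e]]]).
apply: (iffP existsP) => [[k /existsP[v /existsP[e ve]]]|[k [v [e ve]]]].
  by exists k, v, e.
have k_le : k < #|T|.+1.
  have /and5P[_ _ _ /injectiveP v_inj _] := ve.
  by rewrite ltnS -[k]card_ord; apply: leq_card v_inj.
by exists (Ordinal k_le); apply/existsP; exists v; apply/existsP; exists e.
Qed.

Definition is_fvs (T : finType) (H : hypergraph T) (S : {set T}) : bool :=
  (S \subset vset H) && ~~ has_cycle_dec (del_vertices H S).

Lemma is_fvsP (T : finType) (H : hypergraph T) (S : {set T}) :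
  reflect (S \subset vset H /\ ~ has_cycle (del_vertices H S)) (is_fvs H S).
Proof.
apply: (iffP andP) => -[SV acyc]; split=> //.
  by move=> cyc; move/negP: acyc; apply; apply/sumboolP.
by apply/negP => /sumboolP.
Qed.

Lemma is_fvs_vset (T : finType) (H : hypergraph T) : is_fvs H (vset H).
Proof.
apply/is_fvsP; split=> // -[[|k] [v [e]]] /and5P[k2 _ _ _ /andP[/forallP vV _]] //.
by have := vV ord0; rewrite /= setDv inE.
Qed.

Lemma fvs_card_exists (T : finType) (H : hypergraph T) :
  exists n, [exists S : {set T}, is_fvs H S && (#|S| == n)].
Proof.
by exists #|vset H|; apply/existsP; exists (vset H); rewrite is_fvs_vset eqxx.
Qed.

Definition tau_c (T : finType) (H : hypergraph T) : nat :=
  ex_minn (fvs_card_exists H).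

(* Main.v *)
(** View the edges of [H] as the nodes of a graph, adjacent when they meet.  By
    linearity a hypergraph cycle gives a nonempty set of nodes inducing minimum
    degree at least 2, so it suffices to leave a 1-degenerate set of nodes.
    Deleting a vertex in [a :&: c] deletes the nodes [a] and [c], and nodes of
    degree at most 1 can be dropped for free.  A vertex lying in three edges,
    or an adjacent pair [a], [c] whose deletion leaves some [u] with degree at
    most 1, removes three nodes at cost one; otherwise the graph is cubic and
    triangle-free.  A nonempty triangle-free 2-degenerate graph on [n] nodes has
    a solution of cost at most [(n - 1) / 3]: when [u] has neighbours [a] and
    [b], deleting [a] and another neighbour [c] of [a] drops [u] and leaves [b].
    In the cubic triangle-free case, deleting two adjacent nodes of a component
    leaves such a graph, and the spared unit pays for that deletion. *)
Require Import Defs.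
From mathcomp Require Import all_boot all_order all_algebra.
From mathcomp Require Import zify.

Set Implicit Arguments.
Unset Strict Implicit.
Unset Printing Implicit Defensive.

(** * Intersection graphs and degenerate node sets *)

Section EdgeGraph.
Variables (T I : finType) (F : I -> {set T}).
Implicit Types (e f a b c u x y : I) (v : T) (W X Y Z : {set I}) (S : {set T}).

Definition adj e f := (e != f) && ~~ [disjoint F e & F f].

Definition nbs W e := [set f in W | adj e f].

(** Graph-theoretic k-degeneracy of the subgraph induced on [W]; for [k = 1] it says that this
    subgraph is a forest. *)
Definition degenerate k W :=
  forall Z, Z \subset W -> Z != set0 -> exists2 e, e \in Z & #|nbs Z e| <= k.

Definition del W S := [set e in W | [disjoint F e & S]].

Lemma adjP v e f : e != f -> v \in F e -> v \in F f -> adj e f.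
Proof.
move=> ef ve vf; rewrite /adj ef -setI_eq0; apply/set0Pn.
by exists v; rewrite inE ve.
Qed.

Lemma adj_common e f : adj e f -> exists2 v, v \in F e & v \in F f.
Proof.
by case/andP=> _; rewrite -setI_eq0 => /set0Pn[v /setIP[ve vf]]; exists v.
Qed.

Lemma nbsS X W e : X \subset W -> nbs X e \subset nbs W e.
Proof.
move=> XW; apply/subsetP=> f; rewrite !inE => /andP[fX ->].
by rewrite (subsetP XW).
Qed.

Lemma degenerateS k X W : X \subset W -> degenerate k W -> degenerate k X.
Proof. by move=> XW dW Z ZX; apply: dW; apply: subset_trans XW. Qed.

Lemma degenerate0 k : degenerate k set0.
Proof. by move=> Z; rewrite subset0 => ->. Qed.

Lemma degenerateU1 k u W :
  #|nbs W u| <= k -> degenerate k W -> degenerate k (u |: W).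
Proof.
move=> du dW Z ZW Z0; have [uZ|uZ] := boolP (u \in Z).
  exists u => //; apply: leq_trans du; apply: subset_leq_card.
  apply/subsetP=> f; rewrite !inE => /andP[fZ uf]; rewrite uf andbT.
  move: (subsetP ZW f fZ); rewrite !inE => /orP[/eqP fu|//].
  by move: uf; rewrite fu /adj eqxx.
apply: dW => //; apply/subsetP=> f fZ.
move: (subsetP ZW f fZ); rewrite !inE => /orP[/eqP fu|//].
by rewrite -fu fZ in uZ.
Qed.

(** A node of low degree in [Z :&: X] gains no neighbour in [Z], whose other nodes lie in [Y]. *)
Lemma degenerateU k X Y :
    {in X & Y, forall e f, ~~ adj e f} ->
  degenerate k X -> degenerate k Y -> degenerate k (X :|: Y).
Proof.
move=> nXY dX dY Z ZXY Z0; have [ZX0|ZX0] := eqVneq (Z :&: X) set0.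
  apply: dY => //; apply/subsetP=> f fZ.
  move: (subsetP ZXY f fZ); rewrite !inE => /orP[fX|//].
  by move/setP: ZX0 => /(_ f); rewrite !inE fZ fX.
have [e /setIP[eZ eX] de] := dX _ (subsetIr Z X) ZX0.
exists e => //; apply: leq_trans de; apply: subset_leq_card.
apply/subsetP=> f; rewrite !inE => /andP[fZ ef]; rewrite fZ ef andbT /=.
move: (subsetP ZXY f fZ); rewrite !inE => /orP[//|fY].
by move: (nXY _ _ eX fY); rewrite ef.
Qed.

Lemma del_add1 v W S e :
  e \in del W (v |: S) -> [/\ e \in W, v \notin F e & [disjoint F e & S]].
Proof.
by rewrite inE disjoint_sym disjoints_subset subUset sub1set inE
  -disjoints_subset disjoint_sym => /and3P[].
Qed.

Lemma del_set0 W : del W set0 = W.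
Proof. by apply/setP=> e; rewrite !inE disjoint_sym disjoints_subset sub0set andbT. Qed.

(** If [u] survives the deletion, it has at most one neighbour and can be added back last. *)
Lemma del_prune u W S :
    #|nbs W u| <= 1 -> degenerate 1 (del (W :\ u) S) ->
  degenerate 1 (del W S).
Proof.
move=> du dW; apply: (@degenerateS _ _ (u |: del (W :\ u) S)).
  by apply/subsetP=> e; rewrite !inE => /andP[-> ->]; case: eqP.
apply: degenerateU1 => //; apply: leq_trans du; apply/subset_leq_card/nbsS.
by apply/subsetP=> e; rewrite !inE => /andP[/andP[_ ->]].
Qed.

(** Both [a] and [c] contain [v] and disappear with it; [u] can then be pruned. *)
Lemma del_pair v a c u W S :
    v \in F a -> v \in F c -> #|nbs (W :\ a :\ c) u| <= 1 ->
    degenerate 1 (del (W :\ a :\ c :\ u) S) ->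
  degenerate 1 (del W (v |: S)).
Proof.
move=> va vc du /(del_prune du); apply: degenerateS.
apply/subsetP=> e /del_add1[eW ve eS]; rewrite !inE eW eS !andbT.
by apply/andP; split; apply: contraNneq ve => ->.
Qed.

Lemma card_del_pair a c u W :
    a \in W -> c \in W -> u \in W -> c != a -> u != a -> u != c ->
  #|W| = #|W :\ a :\ c :\ u|.+3.
Proof.
move=> aW cW uW ca ua uc; rewrite (cardsD1 a W) aW (cardsD1 c (W :\ a)).
by rewrite !inE ca cW (cardsD1 u (W :\ a :\ c)) !inE ua uc uW.
Qed.

Lemma card_setU1_le v S : #|v |: S| <= #|S|.+1.
Proof. by rewrite cardsU1; case: (_ \notin _); lia. Qed.

(** * Triangle-free 2-degenerate graphs *)

Definition triangle_free W :=
  forall a b c, a \in W -> b \in W -> c \in W ->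
    adj a b -> adj b c -> adj a c -> False.

Lemma degenerate2_fvs W :
    triangle_free W -> degenerate 2 W -> W != set0 ->
  exists S, 3 * #|S| < #|W| /\ degenerate 1 (del W S).
Proof.
have [n] := ubnP #|W|; elim: n W => // n IH W; rewrite ltnS => Wn tfW d2W W0.
have tfS X : X \subset W -> triangle_free X.
  by move=> /subsetP XW a b c aX bX cX; apply: tfW; apply: XW.
have [/existsP[u /andP[uW du]]|] :=
    boolP [exists u, (u \in W) && (#|nbs W u| <= 1)].
  have cW : #|W| = #|W :\ u|.+1 by rewrite (cardsD1 u W) uW.
  have [Wu0|Wu0] := eqVneq (W :\ u) set0.
    exists set0; split; first by rewrite cards0; lia.
    apply: (del_prune du); rewrite Wu0 del_set0; exact: degenerate0.
  have [||||S [cS dS]] := IH (W :\ u) => //.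
  - by lia.
  - by apply: tfS; apply: subsetDl.
  - by apply: degenerateS d2W; apply: subsetDl.
  by exists S; split; [lia | apply: (del_prune du)].
rewrite negb_exists => /forallP dgt1.
have {}dgt1 u : u \in W -> 1 < #|nbs W u|.
  by move=> uW; have := dgt1 u; rewrite uW /= -ltnNge.
(* All degrees now exceed 1, so the node given by 2-degeneracy has degree exactly 2. *)
have [u uW du] := d2W _ (subxx W) W0.
have [a [b [aN bN ab]]] := card_gt1P (dgt1 _ uW).
move: (aN) (bN); rewrite !inE => /andP[aW ua] /andP[bW ub].
have [c cN cu] : exists2 c, c \in nbs W a & c != u.
  have [c [c' [cN c'N cc']]] := card_gt1P (dgt1 _ aW).
  by have [cu|] := eqVneq c u; [exists c' | exists c] => //; rewrite -cu eq_sym.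
move: cN; rewrite inE => /andP[cW ac].
(* Otherwise [u], [a], [c] form a triangle. Hence [b] stays in [W :\ a :\ c :\ u], which is nonempty
   as the induction requires. *)
have bc : b != c.
  by apply/eqP=> bc; apply: (tfW u a c) => //; rewrite -bc.
have [v va vc] := adj_common ac.
have ca : c != a by case/andP: ac; rewrite eq_sym.
have nua : u != a by case/andP: ua.
have nub : u != b by case/andP: ub.
have uc : u != c by rewrite eq_sym.
have cW' := card_del_pair aW cW uW ca nua uc.
have du1 : #|nbs (W :\ a :\ c) u| <= 1.
  have : nbs (W :\ a :\ c) u \subset nbs W u :\ a.
    by apply/subsetP=> f; rewrite !inE => /andP[/and3P[_ -> ->] ->].
  by move: du; rewrite (cardsD1 a (nbs W u)) aN => du /subset_leq_card/leq_trans->.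
have sW' : W :\ a :\ c :\ u \subset W.
  by apply/subsetP=> f; rewrite !inE => /and4P[].
have [||||S [cS dS]] := IH (W :\ a :\ c :\ u).
- by clear -Wn cW'; lia.
- exact: tfS.
- exact: degenerateS d2W.
- by apply/set0Pn; exists b; rewrite !inE eq_sym nub bc eq_sym ab.
exists (v |: S); split; last exact: del_pair dS.
by have := card_setU1_le v S; clear -cS cW'; lia.
Qed.

(** * Graphs of maximum degree 3 *)

(** Each vertex of [e] lies in at most one further edge, so [e] has at most as many neighbours as
    vertices. *)
Lemma nbs_le3 W e :
    (forall v, #|[set f in W | v \in F f]| <= 2) -> e \in W -> #|F e| <= 3 ->
  #|nbs W e| <= 3.
Proof.
move=> dv eW e3; apply: leq_trans e3.
have : nbs W e \subset \bigcup_(v in F e) ([set f in W | v \in F f] :\ e).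
  apply/subsetP=> f; rewrite inE => /andP[fW ef].
  have [v ve vf] := adj_common ef; apply/bigcupP; exists v => //.
  by case/andP: ef => ef _; rewrite !inE fW vf eq_sym ef.
move/subset_leq_card/leq_trans; apply; rewrite -[#|F e|]sum1_card.
apply: (big_rec2 (fun X m => #|X : {set I}| <= m)) => [|v m X ve Xm].
  by rewrite cards0.
apply: leq_trans (leq_card_setU _ _) _; apply: leq_add Xm.
by have := dv v; rewrite (cardsD1 e) inE eW ve.
Qed.

(* A 3-regular set of nodes in a graph of maximum degree 3 is a union of
   components; minimality makes any proper part of it 2-degenerate. *)
Lemma cubic_component_fvs W :
    triangle_free W -> W != set0 -> {in W, forall e, #|nbs W e| = 3} ->
  exists X S, [/\ X \subset W, X != set0, 3 * #|S| <= #|X|,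
    degenerate 1 (del X S) & {in X & W :\: X, forall e f, ~~ adj e f}].
Proof.
move=> tfW W0 d3.
pose P X := (X != set0) && [forall e in X, 2 < #|nbs X e|].
have PW : P W by rewrite /P W0; apply/forall_inP=> e /d3 ->.
have [X /minsetP[/andP[X0 /forall_inP dX] minX] XW] := minset_exists PW.
exists X; have [x xX] := set0Pn _ X0.
have [y [z [yN zN yz]]] := card_gt1P (ltnW (dX x xX)).
move: yN zN; rewrite !inE => /andP[yX xy] /andP[zX xz].
have [v vx vy] := adj_common xy.
have nxy : x != y by case/andP: xy.
have nxz : x != z by case/andP: xz.
have sX' : X :\ x :\ y \subset X by apply/subsetP=> f; rewrite !inE => /and3P[].
have cX : #|X| = #|X :\ x :\ y|.+2.
  by rewrite (cardsD1 x X) xX (cardsD1 y (X :\ x)) !inE yX eq_sym nxy.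
have [|||S [cS dS]] := @degenerate2_fvs (X :\ x :\ y).
- by move=> a b c aX bX cX'; apply: tfW;
    apply: (subsetP XW); apply: (subsetP sX').
(* A [Z] with all degrees above 2 would satisfy [P] and equal [X] by minimality, yet it misses [x]
   and [y]. *)
- move=> Z ZX' Z0; have [/exists_inP[e eZ de]|] :=
    boolP [exists e in Z, #|nbs Z e| <= 2]; first by exists e.
  rewrite negb_exists_in => /forall_inP dZ.
  have ZX : Z \subset X by apply: subset_trans sX'.
  have := minX Z; rewrite /P Z0 ZX => /(_ _ isT) ZXE.
  move: (subset_leq_card ZX'); rewrite ZXE ?cX; first by rewrite ltnNge leqnSn.
  by apply/forall_inP=> e /dZ; rewrite -ltnNge.
- by apply/set0Pn; exists z; rewrite !inE zX eq_sym yz eq_sym nxz.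
(* The strict bound on the [#|X| - 2] other nodes leaves room for [v]: [3 * #|S| + 3 <= #|X|]. *)
exists (v |: S); split=> //.
- by have := card_setU1_le v S; clear -cS cX; lia.
- apply: degenerateS dS; apply/subsetP=> e /del_add1[eX ve eS].
  rewrite !inE eX eS !andbT.
  by apply/andP; split; apply: contraNneq ve => ->.
(* Three neighbours of [e] already lie in [X], so [f] would be a fourth in [W]. *)
move=> e f eX /setDP[fW fX]; apply/negP=> ef.
have : f |: nbs X e \subset nbs W e.
  by rewrite subUset sub1set inE fW ef nbsS.
move/subset_leq_card; rewrite cardsU1 inE (negPf fX) /=.
by rewrite d3 ?(subsetP XW) // add1n leqNgt ltnS (dX e eX).
Qed.

(** * The bound for families of sets of size at most 3 *)

Lemma fvs_third W :
    {in W, forall e, #|F e| <= 3} ->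
  exists S, 3 * #|S| <= #|W| /\ degenerate 1 (del W S).
Proof.
have [n] := ubnP #|W|; elim: n W => // n IH W; rewrite ltnS => Wn e3.
have e3S X : X \subset W -> {in X, forall e, #|F e| <= 3}.
  by move=> /subsetP XW e /XW /e3.
have [W0|W0] := eqVneq W set0.
  exists set0; split; first by rewrite cards0.
  by rewrite W0 del_set0; apply: degenerate0.
have [/existsP[v dv]|] := boolP [exists v, 2 < #|[set f in W | v \in F f]|].
  have cW : #|W| = #|[set f in W | v \in F f]| + #|[set f in W | v \notin F f]|.
    rewrite -(cardsID [set f | v \in F f] W).
    by congr (_ + _); apply: eq_card => f; rewrite !inE // andbC.
  have [||S [cS dS]] := IH [set f in W | v \notin F f].
  - by lia.
  - by apply: e3S; apply/subsetP=> f; rewrite inE => /andP[].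
  exists (v |: S); split; first by have := card_setU1_le v S; lia.
  apply: degenerateS dS; apply/subsetP=> e /del_add1[eW ve eS].
  by rewrite !inE eW ve.
rewrite negb_exists => /forallP dv.
have dle3 e : e \in W -> #|nbs W e| <= 3.
  by move=> eW; apply: nbs_le3 => // [v|]; [rewrite leqNgt | apply: e3].
have [/existsP[u /andP[uW du]]|] :=
    boolP [exists u, (u \in W) && (#|nbs W u| <= 1)].
  have cW : #|W| = #|W :\ u|.+1 by rewrite (cardsD1 u W) uW.
  have [||S [cS dS]] := IH (W :\ u); first by lia.
  - by apply: e3S; apply: subsetDl.
  by exists S; split; [lia | apply: (del_prune du)].
rewrite negb_exists => /forallP dgt1.
have {}dgt1 u : u \in W -> 1 < #|nbs W u|.
  by move=> uW; have := dgt1 u; rewrite uW /= -ltnNge.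
(* The reduction shared by the next two cases: one deleted vertex removes three nodes. *)
have pair a c u : a \in W -> c \in W -> u \in W -> adj a c -> u != a ->
    u != c -> #|nbs (W :\ a :\ c) u| <= 1 ->
    exists S, 3 * #|S| <= #|W| /\ degenerate 1 (del W S).
  move=> aW cW uW ac ua uc du1; have [v va vc] := adj_common ac.
  have ca : c != a by case/andP: ac; rewrite eq_sym.
  have cW' := card_del_pair aW cW uW ca ua uc.
  have [||S [cS dS]] := IH (W :\ a :\ c :\ u).
  - by clear -Wn cW'; lia.
  - by apply: e3S; apply/subsetP=> f; rewrite !inE => /and4P[].
  exists (v |: S); split; last exact: del_pair dS.
  by have := card_setU1_le v S; clear -cS cW'; lia.
(* At a node [u] of degree 2, removing a neighbour [a], paired with any [c] other than [u], leaves
   degree at most 1. *)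
have [/existsP[u /andP[uW du]]|] :=
    boolP [exists u, (u \in W) && (#|nbs W u| <= 2)].
  have [a aN] : exists a, a \in nbs W u.
    by apply/set0Pn; rewrite -card_gt0; have := dgt1 u uW; lia.
  move: (aN); rewrite !inE => /andP[aW ua].
  have [c cN cu] : exists2 c, c \in nbs W a & c != u.
    have [c [c' [cN c'N cc']]] := card_gt1P (dgt1 _ aW).
    by have [cu|] := eqVneq c u; [exists c' | exists c] => //; rewrite -cu eq_sym.
  move: cN; rewrite inE => /andP[cW ac].
  apply: (pair a c u) => //; [by case/andP: ua | by rewrite eq_sym |].
  have : nbs (W :\ a :\ c) u \subset nbs W u :\ a.
    by apply/subsetP=> f; rewrite !inE => /andP[/and3P[_ -> ->] ->].
  by move: du; rewrite (cardsD1 a (nbs W u)) aN => du /subset_leq_card/leq_trans->.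
rewrite negb_exists => /forallP dgt2.
have d3 : {in W, forall e, #|nbs W e| = 3}.
  by move=> e eW; have := dgt2 e; have := dle3 e eW; rewrite eW /=; lia.
(* In a triangle of a cubic graph, removing [a] and [c] leaves [u] only its third neighbour. *)
have [/existsP[u /existsP[a /existsP[c]]]|] := boolP [exists u, exists a,
    exists c, [&& u \in W, a \in W, c \in W, adj u a, adj a c & adj u c]].
  case/and5P=> uW aW cW ua /andP[ac uc].
  have [nua nuc] : u != a /\ u != c by case/andP: ua; case/andP: uc.
  have nac : a != c by case/andP: ac.
  apply: (pair a c u) => //.
  have : nbs (W :\ a :\ c) u \subset nbs W u :\ a :\ c.
    by apply/subsetP=> f; rewrite !inE => /andP[/and3P[-> -> ->] ->].
  move/subset_leq_card; have := d3 u uW.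
  rewrite (cardsD1 a (nbs W u)) (cardsD1 c (nbs W u :\ a)) !inE.
  by rewrite aW cW ua uc (eq_sym c) nac !add1n => -[->].
move=> notri; have tfW : triangle_free W.
  move=> u a c uW aW cW ua ac uc; case/negP: notri.
  apply/existsP; exists u; apply/existsP; exists a; apply/existsP; exists c.
  by rewrite uW aW cW ua ac uc.
have [X [S1 [XW X0 cS1 dS1 nX]]] := cubic_component_fvs tfW W0 d3.
have cW : #|W| = #|X| + #|W :\: X|.
  by rewrite -(cardsID X W) (setIidPr XW).
have [||S2 [cS2 dS2]] := IH (W :\: X).
- by move: X0; rewrite -card_gt0; clear -Wn cW; lia.
- by apply: e3S; apply: subsetDl.
(* No node of [X] is adjacent to the rest, so the two solutions can be united. *)
exists (S1 :|: S2); split.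
  by have [cS _] := leq_card_setU S1 S2; clear -cS cS1 cS2 cW; lia.
apply: (@degenerateS _ _ (del X S1 :|: del (W :\: X) S2)).
  apply/subsetP=> e; rewrite !inE disjoint_sym disjoints_subset subUset.
  rewrite -!disjoints_subset => /and3P[eW]; rewrite !(disjoint_sym _ (F e)).
  by move=> -> ->; rewrite eW; case: (e \in X).
apply: degenerateU => // e f; rewrite !inE => /andP[eX _] /andP[fWX _].
by apply: nX; rewrite ?inE.
Qed.

End EdgeGraph.

(** * From edge graphs back to hypergraphs *)

(** Each edge of a cycle meets its predecessor and its successor, so the edges of a cycle would
    induce minimum degree at least 2. *)
Lemma degenerate1_acyclic (T : finType) (H : hypergraph T) :
  linear_hypergraph H -> degenerate id 1 (eset H) -> ~ has_cycle H.
Proof.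
move=> linH dH [k [v [e]]] /and5P[k2 /injectiveP ei /forallP eH /injectiveP vi].
case/andP=> _ /forallP ve.
have vl i : v i \in e i by apply: (subsetP (ve i)); rewrite !inE eqxx.
have vr i : v (ordS i) \in e i.
  by apply: (subsetP (ve i)); rewrite !inE eqxx orbT.
have neqS (i : 'I_k) : i != ordS i.
  apply/eqP=> /(congr1 val) /=; have := ltn_ord i.
  have [ik|ik] := eqVneq i.+1 k; first by rewrite ik modnn; lia.
  by move=> ?; rewrite modn_small; lia.
(* In a cycle of length 2 the two edges would share two vertices, against linearity; so predecessor
   and successor differ. *)
have neqSS (i : 'I_k) : i != ordS (ordS i).
  apply/eqP=> iSS; have := linH (e i) (e (ordS i)) (eH _) (eH _).
  rewrite (inj_eq ei) neqS => /(_ isT); apply/negP; rewrite -ltnNge.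
  apply/card_gt1P; exists (v i), (v (ordS i)); rewrite !inE vl vr vl (inj_eq vi).
  by split=> //; rewrite {1}iSS vr.
have [||_ /imsetP[i _ ->]] := dH [set e i | i in 'I_k].
- by apply/subsetP=> _ /imsetP[i _ ->].
- by apply/set0Pn; exists (e (Ordinal (ltnW k2))); apply: imset_f.
apply/negP; rewrite -ltnNge; apply/card_gt1P.
have vp : v i \in e (ord_pred i) by have := vr (ord_pred i); rewrite ord_predK.
have neqp : i != ord_pred i.
  by have := neqS (ord_pred i); rewrite ord_predK eq_sym.
exists (e (ordS i)), (e (ord_pred i)); rewrite !inE !imset_f //=; split.
- by apply: (@adjP _ _ id (v (ordS i))); rewrite ?(inj_eq ei).
- by apply: (@adjP _ _ id (v i)); rewrite ?(inj_eq ei).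
- have := neqSS (ord_pred i); rewrite ord_predK eq_sym.
  by rewrite (inj_eq ei).
Qed.

Theorem theorem2p1 (T : finType) (H : hypergraph T)
    (H_uniform : uniform 3 H) (H_linear : linear_hypergraph H) :
  ((tau_c H)%:R <= #|eset H|%:R / 3%:R :> rat)%R.
Proof.
have [S [cS dS]] : exists S : {set T}, 3 * #|S| <= #|eset H| /\
    degenerate id 1 (del id (eset H) S).
  by apply: (@fvs_third _ _ id) => e /H_uniform ->.
(* A feedback vertex set must lie in [vset H]; since every edge does, the intersection meets the
   same edges as [S]. *)
have fvs : is_fvs H (S :&: vset H).
  apply/is_fvsP; split; first exact: subsetIr.
  apply: degenerate1_acyclic.
    by move=> e f; rewrite !inE => /andP[eH _] /andP[fH _]; apply: H_linear.
  apply: degenerateS dS; apply/subsetP=> e; rewrite !inE => /andP[eH].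
  rewrite eH -!setI_eq0 (setIC S) setIA.
  by move/setIidPl: (eset_sub eH) => ->.
have tauS : tau_c H <= #|S|.
  rewrite /tau_c; case: ex_minnP => n _ /(_ #|S :&: vset H|) le_n.
  apply: leq_trans (subset_leq_card (subsetIl S (vset H))); apply: le_n.
  by apply/existsP; exists (S :&: vset H); rewrite fvs eqxx.
rewrite Num.Theory.ler_pdivlMr ?Num.Theory.ltr0n // -GRing.natrM.
by rewrite Num.Theory.ler_nat; lia.
Qed.
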